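(* Let $d\ge1$ and let $g:(0,\infty)^d\to\mathbb C$ be an upper-tail potential with representing measure $\mu_g$. Suppose there are a complex number $\omega$ with $|\omega|=1$ and a number $\kappa\in(0,1]$ such that $$\operatorname{Re}\left(\omega\frac{d\mu_g}{d|\mu_g|}(t)\right)\ge\kappa\quad\text{for }|\mu_g|\text{-almost every }t.$$ Then $g\in\mathrm{RMGM}(\kappa^{-1},\mathbf 1)$, where $\mathbf 1=(1,\dots,1)$. In particular, every upper-tail potential of a positive measure belongs to $\mathrm{RMGM}(1,\mathbf 1)$.
   Context: Products of vectors are componentwise. For $r\in(0,\infty)^d$ put $\mathcal Q(r)=\prod_{k=1}^d(0,r_k)$ and $\mathcal Q^*(r)=\prod_{k=1}^d[r_k,\infty)$. Upper-tail potentials. A complex Radon measure on $(0,\infty)^d$ is understood locally (its total variation $|\mu|$ is finite on compact sets but not necessarily on the whole space); $d\mu/d|\mu|$ is the Radon–Nikodym derivative (polar decomposition). A measurable function $g:(0,\infty)^d\to\mathbb C$ is an upper-tail potential if there is a complex Radon measure $\mu_g$ on $(0,\infty)^d$ such that $g(x)=\mu_g(\mathcal Q^*(x))$ for almost every $x$ and $$\mathcal M_g(r):=\int_{(0,\infty)^d}\prod_{k=1}^d\min\{r_k,t_k\}\,d|\mu_g|(t)<\infty\quad\text{for every }r\in(0,\infty)^d.$$ The second condition implies $|\mu_g|(\mathcal Q^*(x))<\infty$ for every $x$. The measure $\mu_g$ is uniquely determined by the almost-everywhere class of $g$, and $g$ is always represented by its canonical version $g(x)=\mu_g(\mathcal Q^*(x))$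 for every $x$. RMGM. For $K\ge1$ and $\lambda\in[1,\infty)^d$, an upper-tail potential $g$ belongs to $\mathrm{RMGM}(K,\lambda)$ if $\mathcal M_g(r)\le K\int_{\mathcal Q(\lambda r)}|g(x)|\,dx$ for every $r\in(0,\infty)^d$. *)

(* Defs.v *)
From HB Require Import structures.
From mathcomp Require Import all_boot all_order all_algebra.
From mathcomp Require Import all_classical all_reals all_analysis.
From mathcomp Require Import complex.

Set Implicit Arguments.
Unset Strict Implicit.
Unset Printing Implicit Defensive.

Import Order.TTheory GRing.Theory Num.Theory.
Import numFieldNormedType.Exports.

Local Open Scope classical_set_scope.
Local Open Scope ring_scope.
Local Open Scope complex_scope.

(* Points of R^d are d-tuples, with the product sigma-algebra of the Borel
   sigma-algebra of R (the Borel sigma-algebra of R^d). *)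

(* d-dimensional Lebesgue measure: the image of lambda_1 \x lambda_(d-1) under
   (x, t) |-> x :: t. *)
Fixpoint lebesgue_tuple (R : realType) (d : nat) : set (d.-tuple R) -> \bar R :=
  match d return set (d.-tuple R) -> \bar R with
  | 0 => dirac [tuple]
  | m.+1 => pushforward (lebesgue_measure \x @lebesgue_tuple R m)%E
              (fun p : R * m.-tuple R => [tuple of p.1 :: p.2])
  end.
Arguments lebesgue_tuple {R} d.

Section defs.
Context {R : realType} {d : nat}.
Implicit Types (A B : set (d.-tuple R)) (x t r : d.-tuple R).

Local Notation normc := ComplexField.Normc.normc.

Definition orthant : set (d.-tuple R) := [set x | forall k, 0 < tnth x k].

Definition mulT (x t : d.-tuple R) : d.-tuple R :=
  [tuple tnth x k * tnth t k | k < d].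

Definition lower_box r : set (d.-tuple R) :=
  [set x | forall k, 0 < tnth x k < tnth r k].

Definition upper_box r : set (d.-tuple R) :=
  [set x | forall k, tnth r k <= tnth x k].

(* Tuples carry no topology in the library, row vectors do. *)
Definition relatively_compact A := exists C : set 'rV[R]_d,
  [/\ compact C, forall v, C v -> forall k, 0 < v ord0 k &
      forall t, A t -> C (\row_k tnth t k)].

Definition bounded_borel A := measurable A /\ relatively_compact A.

(* The total variation of an arbitrary Borel set is computed from finite
   disjoint families of relatively compact pieces, the only sets on which a
   local complex measure is defined. *)
Definition variation_measure (mu : set (d.-tuple R) -> R[i]) A : \bar R :=
  ereal_sup [set s | exists n (F : 'I_n -> set (d.-tuple R)),
    [/\ forall i, bounded_borel (F i) /\ F i `<=` A,
        trivIset setT F & s = (\sum_(i < n) normc (mu (F i)))%:E]].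

(* A complex Radon measure on (0, oo)^d: a countably additive complex set
   function on the relatively compact Borel subsets of (0, oo)^d (its values on
   other sets are irrelevant), with locally finite total variation.  Regularity
   is automatic on (0, oo)^d.  Series in C converge componentwise. *)
Definition complex_radon (mu : set (d.-tuple R) -> R[i]) :=
  (forall F : nat -> set (d.-tuple R),
    (forall i, measurable (F i)) -> trivIset setT F ->
    relatively_compact (\bigcup_i F i) ->
    (fun n => \sum_(i < n) complex.Re (mu (F i))) @ \oo
      --> complex.Re (mu (\bigcup_i F i)) /\
    (fun n => \sum_(i < n) complex.Im (mu (F i))) @ \oo
      --> complex.Im (mu (\bigcup_i F i)))
  /\ (forall A, bounded_borel A -> (variation_measure mu A < +oo)%E).

(* Value of mu on a Borel set of finite total variation that need not be
   relatively compact, by exhaustion with the compact boxes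
   [1/(n+1), n+1]^d. *)
Definition exhaustion (n : nat) : set (d.-tuple R) :=
  [set t | forall k, n.+1%:R^-1 <= tnth t k <= n.+1%:R].

Definition extended_value (mu : set (d.-tuple R) -> R[i]) A : R[i] :=
  limn (fun n => complex.Re (mu (A `&` exhaustion n))) +i*
  limn (fun n => complex.Im (mu (A `&` exhaustion n))).

(* h = d mu / d |mu| *)
Definition is_RN_derivative (mu : set (d.-tuple R) -> R[i])
    (h : d.-tuple R -> R[i]) :=
  let tv := variation_measure mu in
  measurable_fun orthant (fun t => complex.Re (h t)) /\
  measurable_fun orthant (fun t => complex.Im (h t)) /\
  forall A, bounded_borel A ->
    [/\ tv.-integrable A (fun t => (complex.Re (h t))%:E),
        tv.-integrable A (fun t => (complex.Im (h t))%:E) &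
        mu A = fine (\int[tv]_(t in A) (complex.Re (h t))%:E)%E +i*
               fine (\int[tv]_(t in A) (complex.Im (h t))%:E)%E].

Definition tail_mass (mu : set (d.-tuple R) -> R[i]) r : \bar R :=
  (\int[variation_measure mu]_(t in orthant)
     (\prod_(k < d) Num.min (tnth r k) (tnth t k))%:E)%E.

Definition is_upper_tail_potential (g : d.-tuple R -> R[i])
    (mu : set (d.-tuple R) -> R[i]) :=
  [/\ complex_radon mu,
      measurable_fun orthant (fun t => complex.Re (g t)),
      measurable_fun orthant (fun t => complex.Im (g t)),
      {ae lebesgue_tuple d, forall x, orthant x ->
         g x = extended_value mu (upper_box x)} &
      forall r, orthant r -> (tail_mass mu r < +oo)%E].

(* The representing measure of g is unique, so the existential below denotes
   "the" measure mu_g; the integral only sees the a.e. class of g. *)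
Definition RMGM (K : R) (lam : d.-tuple R) (g : d.-tuple R -> R[i]) :=
  [/\ 1 <= K, forall k, 1 <= tnth lam k &
      exists2 mu, is_upper_tail_potential g mu &
        forall r, orthant r ->
          (tail_mass mu r <=
           K%:E * \int[lebesgue_tuple d]_(x in lower_box (mulT lam r))
                    (normc (g x))%:E)%E].

Definition is_positive (mu : set (d.-tuple R) -> R[i]) :=
  forall A, bounded_borel A -> 0 <= mu A.

End defs.

(* Main.v *)
From HB Require Import structures.
Require Import Defs.
From mathcomp Require Import all_boot all_order all_algebra.
From mathcomp Require Import all_classical all_reals all_analysis.
From mathcomp Require Import complex measurable_realfun lra.
Import Order.TTheory GRing.Theory Num.Theory.
Import numFieldNormedType.Exports.
Local Open Scope classical_set_scope.
Local Open Scope ring_scope.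

Set Implicit Arguments.
Unset Strict Implicit.
Unset Printing Implicit Defensive.

(** Why the statement holds.  For a positive measure [nu] on the orthant,
    [min r_k t_k] is the length of [{y | 0 < y < r_k, y <= t_k}], so
    [\prod_k min r_k t_k] is the Lebesgue measure of the points of the lower box
    of [r] lying below [t]; by Tonelli
    [[
      int (\prod_k min r_k t_k) dnu(t) = int_(lower box of r) nu(upper_box x) dx.
    ]]
    Take [nu = |mu|].  If the density [h] of [mu] satisfies
    [Re (omega h) >= kappa], then integrating over the upper box of [x] gives
    [|g(x)| = |mu (upper_box x)| >= Re (omega * mu (upper_box x))
    >= kappa * |mu| (upper_box x)], and integrating in [x] gives the theorem.

    Both halves of the theorem go through [RMGM_of_domination], whose hypothesis
    is [c * |mu| B <= Re (omega * mu B)] for relatively compact Borel [B].  With a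
    density it is [RN_domination]; for a positive [mu] it is
    [positive_domination] with [c = omega = 1], read off the definition of the
    total variation without choosing a density.

    Three facts support this argument.  [variation_sigma_additive] makes the
    total variation, a supremum over finite disjoint families, a measure; it is
    sigma-finite because [mu] has locally finite variation.  The [d]-dimensional
    Lebesgue measure is sigma-finite and multiplicative on boxes
    ([lebesgue_tuple_box]).  Finally an upper box is not relatively compact, and
    [mu] is evaluated on it as a limit along an exhaustion: the limit exists by
    [complex_radon_cvg], because [|mu| (upper_box x)] is finite, and the
    domination inequality passes to it in [normc_extended_value]. *)

(** * Lebesgue measure on tuples *)

Section coordinates.
Context {R : realType} {d : nat}.

Lemma measurable_forall_ord d1 (T : measurableType d1) (A : 'I_d -> set T) :
  (forall k, measurable (A k)) -> measurable [set x | forall k, A k x].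
Proof.
move=> mA; rewrite (_ : mkset _ = \bigcap_(k in setT) A k); last first.
  by apply/seteqP; split => x /= h => [k _|k]; [exact: h|exact: (h k)].
by apply: fin_bigcap_measurable => // k _; exact: mA.
Qed.

Lemma measurable_box (A : 'I_d -> set R) : (forall k, measurable (A k)) ->
  measurable [set x : d.-tuple R | forall k, A k (tnth x k)].
Proof.
move=> mA; apply: (@measurable_forall_ord _ _ (fun k => (@tnth d R)^~ k @^-1` A k)).
by move=> k; rewrite -[X in measurable X]setTI; exact: measurable_tnth.
Qed.

End coordinates.

Section lebesgue_cons.
Context {R : realType} {n : nat}.
Variable m : {sigma_finite_measure set (n.-tuple R) -> \bar R}.

(** Written like the map in [lebesgue_tuple], so that [lebesgue_cons] is one step
    of that recursion up to conversion. *)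
Definition tuple_of_cons (p : R * n.-tuple R) : n.+1.-tuple R :=
  [tuple of p.1 :: p.2].

Lemma measurable_tuple_of_cons : measurable_fun setT tuple_of_cons.
Proof. exact: measurable_cons. Qed.

Definition lebesgue_cons :=
  pushforward (lebesgue_measure \x m)%E tuple_of_cons.

Let lebesgue_cons0 : lebesgue_cons set0 = 0%E.
Proof. by rewrite /lebesgue_cons /pushforward preimage_set0 measure0. Qed.

Let lebesgue_cons_ge0 A : (0 <= lebesgue_cons A)%E.
Proof. by rewrite /lebesgue_cons /pushforward. Qed.

Let lebesgue_cons_sigma_additive : semi_sigma_additive lebesgue_cons.
Proof.
move=> F mF tF mUF.
(* The measure instance of [pushforward] depends on a proof of measurability,
   so it is given explicitly. *)
pose nu : {measure set (n.+1.-tuple R) -> \bar R} :=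
  @measure_function_pushforward__canonical__measure_function_Measure
   _ _ _ _ _ (lebesgue_measure \x m)%E _ measurable_tuple_of_cons.
exact: (@measure_semi_sigma_additive _ _ _ nu).
Qed.

HB.instance Definition _ := isMeasure.Build _ _ _ lebesgue_cons
  lebesgue_cons0 lebesgue_cons_ge0 lebesgue_cons_sigma_additive.

(** A product of exhausting sequences covers the product space; it is carried to
    tuples by the measurable inverse [split] of [tuple_of_cons]. *)
Let lebesgue_cons_sigma_finite : sigma_finite setT lebesgue_cons.
Proof.
have /sigma_finiteP[F [FT ndF Ffin]] := sigma_finiteT (@lebesgue_measure R).
have /sigma_finiteP[G [GT ndG Gfin]] := sigma_finiteT m.
pose split (t : n.+1.-tuple R) : R * n.-tuple R := (thead t, [tuple of behead t]).
have consK p : split (tuple_of_cons p) = p.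
  case: p => x t; congr pair => //.
  exact/val_inj.
have msplit : measurable_fun setT split.
  apply/measurable_fun_pair => /=; first exact: measurable_tnth.
  apply/measurable_fun_tnthP => k.
  rewrite (_ : _ \o _ = (@tnth n.+1 R)^~ (lift ord0 k)); first exact: measurable_tnth.
  apply/funext => t /=; rewrite tnth_behead; congr tnth.
  by apply/val_inj; rewrite /= inordK ?ltnS.
exists (fun k => split @^-1` (F k `*` G k)).
  apply/esym; rewrite -preimage_bigcup -subTset => t _ /=.
  have [i _ Fi] : (\bigcup_i F i) (split t).1 by rewrite -FT.
  have [j _ Gj] : (\bigcup_j G j) (split t).2 by rewrite -GT.
  exists (maxn i j) => //; split.
  - by move: Fi; exact/subsetPset/ndF/leq_maxl.
  - by move: Gj; exact/subsetPset/ndG/leq_maxr.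
move=> k; have [mF Fk] := Ffin k; have [mG Gk] := Gfin k; split.
  by rewrite -[X in measurable X]setTI; apply: msplit => //; exact: measurableX.
rewrite /lebesgue_cons /pushforward -comp_preimage.
rewrite (_ : split \o _ = id); last by apply/funext => p; exact: consK.
by rewrite preimage_id product_measure1E// lte_mul_pinfty// ge0_fin_numE.
Qed.

HB.instance Definition _ := Measure_isSigmaFinite.Build _ _ _ lebesgue_cons
  lebesgue_cons_sigma_finite.

Lemma lebesgue_cons_box (A : 'I_n.+1 -> set R) : (forall k, measurable (A k)) ->
  lebesgue_cons [set x | forall k, A k (tnth x k)] =
  (lebesgue_measure (A ord0) *
   m [set x | forall k, A (lift ord0 k) (tnth x k)])%E.
Proof.
move=> mA; rewrite -product_measure1E; last 2 first.
- exact: mA.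
- by apply: (measurable_box (A := fun k => A (lift ord0 k))) => k; exact: mA.
rewrite /lebesgue_cons /pushforward; congr ((_ \x _)%E _).
apply/seteqP; split => -[x t] /= h.
  by split => [|k]; [exact: (h ord0)|have := h (lift ord0 k); rewrite tnthS].
by case: h => h0 h1 k; case: (unliftP ord0 k) => [j|] ->; rewrite ?tnthS.
Qed.

End lebesgue_cons.

Section lebesgue_tuple.
Context {R : realType}.

(** [lebesgue_tuple] is a bare set function; the bundled copy gives access to the
    theory of sigma-finite measures. *)
Fixpoint lebesgue_tupleM d : {sigma_finite_measure set (d.-tuple R) -> \bar R} :=
  match d return {sigma_finite_measure set (d.-tuple R) -> \bar R} with
  | 0 => [the {sigma_finite_measure set _ -> \bar _} of dirac [tuple]]
  | n.+1 => [the {sigma_finite_measure set _ -> \bar _} of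
               lebesgue_cons (lebesgue_tupleM n)]
  end.

Lemma lebesgue_tupleME d : lebesgue_tupleM d = lebesgue_tuple d :> (set _ -> _).
Proof. by elim: d => [|d IH] //=; rewrite -IH. Qed.

Lemma lebesgue_tuple_box d (A : 'I_d -> set R) : (forall k, measurable (A k)) ->
  lebesgue_tuple d [set x | forall k, A k (tnth x k)] =
  (\prod_(k < d) lebesgue_measure (A k))%E.
Proof.
move=> mA; rewrite -lebesgue_tupleME; elim: d A mA => [|d IH] A mA.
  by rewrite big_ord0 /= diracE mem_set//= => -[].
by rewrite big_ord_recl -IH//= lebesgue_cons_box.
Qed.

End lebesgue_tuple.

(** * Total variation of a local complex measure *)

Section complex_parts.
Context {R : realType}.
Local Notation normc := ComplexField.Normc.normc.
Implicit Types z w : R[i].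

Lemma complexReD z w : complex.Re (z + w) = complex.Re z + complex.Re w.
Proof. by case: z; case: w. Qed.

Lemma complexImD z w : complex.Im (z + w) = complex.Im z + complex.Im w.
Proof. by case: z; case: w. Qed.

Lemma complexReM z w : complex.Re (z * w) =
  complex.Re z * complex.Re w - complex.Im z * complex.Im w.
Proof. by case: z; case: w. Qed.

Lemma normc_sqrt z : normc z = Num.sqrt (complex.Re z ^+ 2 + complex.Im z ^+ 2).
Proof. by case: z. Qed.

Lemma normc_ge0 z : 0 <= normc z.
Proof. by rewrite normc_sqrt sqrtr_ge0. Qed.

Lemma ler_norm_Re z : `|complex.Re z| <= normc z.
Proof. by rewrite normc_sqrt -sqrtr_sqr ler_wsqrtr// lerDl sqr_ge0. Qed.

Lemma ler_norm_Im z : `|complex.Im z| <= normc z.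
Proof. by rewrite normc_sqrt -sqrtr_sqr ler_wsqrtr// lerDr sqr_ge0. Qed.

Lemma complexRe_sum I (s : seq I) (F : I -> R[i]) :
  complex.Re (\sum_(i <- s) F i) = \sum_(i <- s) complex.Re (F i).
Proof. exact: (big_morph _ complexReD). Qed.

Lemma complexIm_sum I (s : seq I) (F : I -> R[i]) :
  complex.Im (\sum_(i <- s) F i) = \sum_(i <- s) complex.Im (F i).
Proof. exact: (big_morph _ complexImD). Qed.

Lemma ler_normc_sum I (s : seq I) (F : I -> R[i]) :
  normc (\sum_(i <- s) F i) <= \sum_(i <- s) normc (F i).
Proof.
elim: s => [|i s IH]; first by rewrite !big_nil ComplexField.Normc.normc0.
rewrite !big_cons; apply: (le_trans (le_normcD _ _)); exact: lerD.
Qed.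

End complex_parts.

Section local_sets.
Context {R : realType} {d : nat}.
Implicit Types (A B E : set (d.-tuple R)) (r t x : d.-tuple R).

Lemma relatively_compactS A B :
  A `<=` B -> relatively_compact B -> relatively_compact A.
Proof. by move=> AB [C [cC C0 BC]]; exists C; split => // t /AB /BC. Qed.

Lemma bounded_borelS A B :
  measurable A -> A `<=` B -> bounded_borel B -> bounded_borel A.
Proof. by move=> mA AB [_ rB]; split => //; exact: relatively_compactS rB. Qed.

Lemma bounded_borelIl E A :
  measurable A -> bounded_borel E -> bounded_borel (E `&` A).
Proof.
move=> mA bE; apply: bounded_borelS (bE); last exact: subIsetl.
by apply: measurableI => //; case: bE.
Qed.

Lemma bounded_borel_orthant E : bounded_borel E -> E `<=` orthant.
Proof.
move=> [_ [C [_ C0 EC]]] t /EC /C0 t0 k.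
by have := t0 k; rewrite mxE.
Qed.

Lemma measurable_orthant : measurable (@orthant R d).
Proof.
rewrite (_ : orthant = [set x | forall k, `]0, +oo[%classic (tnth x k)]).
  by apply: (measurable_box (A := fun=> `]0, +oo[%classic)) => k; exact: measurable_itv.
by apply/seteqP; split => x /= x0 k; have := x0 k; rewrite in_itv/= andbT.
Qed.

Lemma measurable_upper_box x : measurable (upper_box x).
Proof.
rewrite (_ : upper_box x = [set t | forall k, `[tnth x k, +oo[%classic (tnth t k)]).
  apply: (measurable_box (A := fun k => `[tnth x k, +oo[%classic)) => k.
  exact: measurable_itv.
by apply/seteqP; split => t /= h k; have := h k; rewrite in_itv/= andbT.
Qed.

Lemma measurable_lower_box r : measurable (lower_box r).
Proof.
rewrite (_ : lower_box r = [set t | forall k, `]0, tnth r k[%classic (tnth t k)]).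
  apply: (measurable_box (A := fun k => `]0, tnth r k[%classic)) => k.
  exact: measurable_itv.
by apply/seteqP; split => t /= h k; have := h k; rewrite in_itv.
Qed.

Lemma exhaustion_box n : @exhaustion R d n =
  [set t | forall k, `[n.+1%:R^-1, n.+1%:R]%classic (tnth t k)].
Proof. by apply/seteqP; split => t /= h k; have := h k; rewrite in_itv. Qed.

Lemma bounded_borel_exhaustion n : bounded_borel (@exhaustion R d n).
Proof.
split.
  rewrite exhaustion_box; apply: (measurable_box (A := fun=> `[_, _]%classic)) => k.
  exact: measurable_itv.
exists [set v | forall k, `[n.+1%:R^-1, n.+1%:R]%classic (v ord0 k)]; split.
- apply: (@rV_compact R d (fun=> `[n.+1%:R^-1, n.+1%:R]%classic)) => k.
  exact: segment_compact.
- move=> v /= h k; have := h k; rewrite in_itv/= => /andP[+ _].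
  by apply: lt_le_trans; rewrite invr_gt0.
- by move=> t h k; rewrite mxE /= in_itv/=; exact: (h k).
Qed.

Lemma nondecreasing_exhaustion :
  {homo @exhaustion R d : n m / (n <= m)%N >-> n `<=` m}.
Proof.
move=> n m nm t h k; have /andP[h1 h2] := h k; apply/andP; split.
  by apply: le_trans h1; rewrite lef_pV2 ?posrE// ler_nat.
by apply: (le_trans h2); rewrite ler_nat.
Qed.

Lemma bigcup_exhaustion : \bigcup_n @exhaustion R d n = orthant.
Proof.
apply/seteqP; split => t.
  by move=> [n _] /(bounded_borel_orthant (bounded_borel_exhaustion n)).
move=> t0; pose s := \sum_k (tnth t k + (tnth t k)^-1).
(* One bound [s] above every coordinate and every inverse coordinate puts [t]
   in the box whose index is the integer part of [s]. *)
have s_ge k : tnth t k + (tnth t k)^-1 <= s.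
  rewrite /s (bigD1 k)//= lerDl sumr_ge0// => j _.
  by rewrite addr_ge0// ?invr_ge0 ltW.
exists (Num.truncn s) => // k.
have tk0 := t0 k.
have /ltW sn := truncnS_gt s.
apply/andP; split; last first.
  by apply: le_trans sn; apply: le_trans (s_ge k); rewrite lerDl invr_ge0 ltW.
rewrite -[leRHS]invrK lef_pV2 ?posrE ?invr_gt0//.
by apply: le_trans sn; apply: le_trans (s_ge k); rewrite lerDr ltW.
Qed.

End local_sets.

Section variation.
Context {R : realType} {d : nat}.
Variable mu : set (d.-tuple R) -> R[i].
Implicit Types (A B E : set (d.-tuple R)).
Local Notation normc := ComplexField.Normc.normc.
Local Notation tv := (variation_measure mu).

Lemma variation_ge0 A : (0 <= tv A)%E.
Proof.
apply: ereal_sup_ubound; exists 0%N, (fun=> set0).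
by split; [case|by move=> [] []|rewrite big_ord0].
Qed.

Lemma le_variation A B : A `<=` B -> (tv A <= tv B)%E.
Proof.
move=> AB; apply: ge_ereal_sup => _ [n [F [FA tF ->]]].
apply: ereal_sup_ubound; exists n, F; split => // i.
by have [bF Fi] := FA i; split => //; exact: subset_trans AB.
Qed.

Lemma normc_le_variation E : bounded_borel E -> ((normc (mu E))%:E <= tv E)%E.
Proof.
move=> bE; apply: ereal_sup_ubound; exists 1%N, (fun=> E).
split => [i|i j _ _ _|]; [by split|by rewrite !ord1|by rewrite big_ord1].
Qed.

(** The pieces in the supremum are relatively compact in the open orthant, hence
    the complement of the orthant does not contribute. *)
Lemma variation_orthant A : tv (A `&` orthant) = tv A.
Proof.
apply/eqP; rewrite eq_le; apply/andP; split.
  by apply: le_variation; exact: subIsetl.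
apply: ge_ereal_sup => _ [n [F [FA tF ->]]].
apply: ereal_sup_ubound; exists n, F; split => // i.
have [bF Fi] := FA i; split => // t Ft; split; first exact: Fi.
exact: bounded_borel_orthant Ft.
Qed.

(** A family inside [A] and a family inside [B] concatenate to a disjoint family
    inside the union. *)
Lemma variation_superadditive A B : A `&` B = set0 ->
  (tv A + tv B <= tv (A `|` B))%E.
Proof.
move=> AB0.
pose S A := [set s | exists n (F : 'I_n -> set (d.-tuple R)),
    [/\ forall i, bounded_borel (F i) /\ F i `<=` A,
        trivIset setT F & s = (\sum_(i < n) normc (mu (F i)))%:E]].
have key a b : S A a -> S B b -> (a + b <= tv (A `|` B))%E.
  move=> [n [F [FA tF ->]]] [m [G [GB tG ->]]].
  apply: ereal_sup_ubound; exists (n + m)%N.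
  exists (fun i => match fintype.split i with inl j => F j | inr j => G j end); split.
  - move=> i; case: (fintype.split i) => j.
      by have [? h] := FA j; split => // t /h; left.
    by have [? h] := GB j; split => // t /h; right.
  - move=> i j _ _; rewrite -{2}(fintype.splitK i) -{2}(fintype.splitK j).
    case: (fintype.split i) => i'; case: (fintype.split j) => j' /=.
    + by move/(tF _ _ I I) ->.
    + move=> [t [/(proj2 (FA _)) tA /(proj2 (GB _)) tB]].
      by have : (A `&` B) t by []; rewrite AB0.
    + move=> [t [/(proj2 (GB _)) tB /(proj2 (FA _)) tA]].
      by have : (A `&` B) t by []; rewrite AB0.
    + by move/(tG _ _ I I) ->.
  - rewrite -EFinD big_split_ord/=; congr (_ + _)%:E; apply: eq_bigr => i _.
      by rewrite -[lshift _ _]/(unsplit (inl i)) unsplitK.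
    by rewrite -[rshift _ _]/(unsplit (inr i)) unsplitK.
(* The two suprema are taken one after the other, so that the summand moved to
   the right-hand side is finite each time; [tv A = +oo] is treated apart. *)
have key2 b : S B b -> (tv A + b <= tv (A `|` B))%E.
  move=> Sb; have [r br] : exists r, b = r%:E.
    by case: Sb => n [F [_ _ ->]]; eexists.
  rewrite br -leeBrDr//; apply: ge_ereal_sup => a Sa.
  by rewrite leeBrDr// -br; exact: key.
have : tv A != -oo%E by rewrite gt_eqF// (lt_le_trans _ (variation_ge0 A)).
case tvA : (tv A) => [r| |]//= _.
  rewrite addeC -leeBrDr//; apply: ge_ereal_sup => b Sb.
  by rewrite leeBrDr// addeC -tvA; exact: key2.
have : (tv A + 0 <= tv (A `|` B))%E.
  apply: key2; exists 0%N, (fun=> set0).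
  by split; [case|by move=> [] []|rewrite big_ord0].
by rewrite adde0 tvA leye_eq => /eqP ->; rewrite leey.
Qed.

Lemma variation_superadditive_sum (F : nat -> set (d.-tuple R)) n :
  trivIset setT F ->
  (\sum_(0 <= i < n) tv (F i) <= tv (\big[setU/set0]_(i < n) F i))%E.
Proof.
move=> tF; elim: n => [|n IH]; first by rewrite big_nil variation_ge0.
rewrite big_nat_recr//= big_ord_recr/=.
apply: le_trans (variation_superadditive _); first exact: leeD2r.
by apply: (@trivIset_bigsetUI _ predT) => // i j _ _; exact: tF.
Qed.

Hypothesis hmu : complex_radon mu.

(** The triangle inequality for the convergent series
    [mu E = \sum_i mu (E `&` F i)], obtained by continuity of the modulus. *)
Lemma normc_le_nneseries E (F : nat -> set (d.-tuple R)) :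
  bounded_borel E -> (forall i, measurable (F i)) -> trivIset setT F ->
  E `<=` \bigcup_i F i ->
  ((normc (mu E))%:E <= \sum_(i <oo) (normc (mu (E `&` F i)))%:E)%E.
Proof.
move=> bE mF tF EF.
have EE : \bigcup_i (E `&` F i) = E by rewrite -setI_bigcupr; exact/setIidPl.
have [|||ReE ImE] := proj1 hmu (fun i => E `&` F i).
- by move=> i; apply: measurableI => //; case: bE.
- exact: trivIset_setIl.
- by rewrite EE; case: bE.
rewrite EE in ReE ImE.
set S := fun n => \sum_(i < n) mu (E `&` F i).
have cvS : (normc (S n))%:E @[n --> \oo] --> (normc (mu E))%:E.
  apply: cvg_EFin; first by apply: nearW => n.
  rewrite normc_sqrt (_ : _ \o _ = fun n => Num.sqrt (
    (\sum_(i < n) complex.Re (mu (E `&` F i))) ^+ 2 +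
    (\sum_(i < n) complex.Im (mu (E `&` F i))) ^+ 2)); last first.
    by apply/funext => n; rewrite /= normc_sqrt /S complexRe_sum complexIm_sum.
  apply: continuous_cvg; first exact: sqrt_continuous.
  by apply: cvgD; apply: cvgM.
rewrite -(cvg_lim _ cvS)//; apply: lime_le; first by apply/cvg_ex; eexists; exact: cvS.
apply: nearW => n.
apply: le_trans (_ : (\sum_(0 <= i < n) (normc (mu (E `&` F i)))%:E <= _)%E).
  by rewrite sumEFin lee_fin big_mkord ler_normc_sum.
by apply: nneseries_lim_ge => k _ _; rewrite lee_fin normc_ge0.
Qed.

(** Cutting every piece of a family along the [F i] bounds the total variation of
    the union from above; superadditivity bounds it from below. *)
Lemma variation_sigma_additive : semi_sigma_additive tv.
Proof.
move=> F mF tF mUF.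
rewrite (_ : tv _ = \sum_(i <oo) tv (F i))%E; last first.
  apply/eqP; rewrite eq_le; apply/andP; split.
    apply: ge_ereal_sup => _ [n [E [EF tE ->]]].
    rewrite -sumEFin.
    apply: (@le_trans _ _ (\sum_(j < n) \sum_(i <oo) (normc (mu (E j `&` F i)))%:E)%E).
      by apply: lee_sum => j _; have [bE ?] := EF j; exact: normc_le_nneseries.
    rewrite -nneseries_sum; last by move=> *; rewrite lee_fin normc_ge0.
    apply: lee_nneseries.
      by move=> i _ _; apply: sume_ge0 => j _; rewrite lee_fin normc_ge0.
    move=> i _; rewrite sumEFin; apply: ereal_sup_ubound.
    exists n, (fun j => E j `&` F i); split => //.
      move=> j; split; last exact: subIsetr.
      by apply: bounded_borelIl => //; have [] := EF j.
    exact: trivIset_setIr.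
  apply: lime_le; first by apply: is_cvg_nneseries => *; exact: variation_ge0.
  apply: nearW => n; apply: (le_trans (variation_superadditive_sum n tF)).
  by apply: le_variation; exact: bigsetU_bigcup.
by apply: is_cvg_nneseries => *; exact: variation_ge0.
Qed.

(** Superadditivity gives [2 * tv set0 <= tv set0], and [tv set0] is finite as
    the empty set is relatively compact. *)
Lemma variation0 : tv set0 = 0%E.
Proof.
have fin : tv set0 \is a fin_num.
  rewrite ge0_fin_numE ?variation_ge0//; apply: (proj2 hmu).
  by apply: bounded_borelS (bounded_borel_exhaustion 0).
have := variation_superadditive (setI0 set0).
rewrite setU0 -{3}[tv set0]adde0 leeD2lE// => h.
by apply/eqP; rewrite eq_le h variation_ge0.
Qed.

End variation.

(** * The tail mass as an integral over a lower box *)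

Section variation_measure.
Context {R : realType} {d : nat}.
Variables (mu : set (d.-tuple R) -> R[i]) (hmu : complex_radon mu).

(** The proof of [complex_radon mu] is an argument so that the measure instance,
    which depends on it, can be inferred from the term. *)
Definition variationM of complex_radon mu := variation_measure mu.

HB.instance Definition _ := isMeasure.Build _ _ _ (variationM hmu)
  (variation0 hmu) (variation_ge0 mu) (variation_sigma_additive hmu).

(** The complement of the orthant is null, so adding it to the compact boxes
    covers the whole space with sets of finite variation. *)
Let variationM_sigma_finite : sigma_finite setT (variationM hmu).
Proof.
exists (fun n => ~` orthant `|` exhaustion n).
  apply/esym; rewrite -subTset => t _; have [|t0] := pselect (orthant t).
    by rewrite -bigcup_exhaustion => -[n _ tn]; exists n => //; right.
  by exists 0%N => //; left.
have mC := measurableC (@measurable_orthant R d).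
move=> n; have [mE _] := @bounded_borel_exhaustion R d n.
split; first exact: measurableU.
rewrite /variationM -variation_orthant setIUl setICl set0U variation_orthant.
by apply: (proj2 hmu); exact: bounded_borel_exhaustion.
Qed.

HB.instance Definition _ := Measure_isSigmaFinite.Build _ _ _ (variationM hmu)
  variationM_sigma_finite.

End variation_measure.

Section tail_mass.
Context {R : realType} {d : nat}.
Variables (mu : set (d.-tuple R) -> R[i]) (hmu : complex_radon mu).
Implicit Types r t x : d.-tuple R.
Local Notation tv := (variation_measure mu).

Lemma lebesgue_measure_itv_min (a b : R) : 0 < a -> 0 < b ->
  lebesgue_measure (`]0, a[ `&` `]-oo, b])%classic = (Num.min a b)%:E.
Proof.
move=> a0 b0; have [ab|ba] := leP a b.
  rewrite (_ : _ `&` _ = `]0, a[%classic).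
    by rewrite lebesgue_measure_itv/= lte_fin a0 oppr0 adde0.
  apply/seteqP; split => y /=; rewrite !in_itv/=; first by case.
  by move=> /andP[-> ya]; rewrite ya (le_trans (ltW ya)).
rewrite (_ : _ `&` _ = `]0, b]%classic).
  by rewrite lebesgue_measure_itv/= lte_fin b0 oppr0 adde0.
apply/seteqP; split => y /=; rewrite !in_itv/=; first by case=> /andP[-> _] ->.
by move=> /andP[-> yb]; rewrite yb (le_lt_trans yb).
Qed.

(** The product of minima in the tail mass is the volume of a box. *)
Lemma lebesgue_tuple_min_box r t : orthant r -> orthant t ->
  lebesgue_tuple d [set x | lower_box r x /\ upper_box x t] =
  (\prod_(k < d) Num.min (tnth r k) (tnth t k))%:E.
Proof.
move=> r0 t0.
rewrite (_ : mkset _ = [set x | forall k,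
  (`]0, tnth r k[ `&` `]-oo, tnth t k])%classic (tnth x k)]); last first.
  apply/seteqP; split => x /=.
    by move=> [h1 h2] k; rewrite !in_itv/= h1; split => //; exact: h2.
  by move=> h; split => k; have [] := h k; rewrite !in_itv.
rewrite (lebesgue_tuple_box (A := fun k => `]0, tnth r k[ `&` `]-oo, tnth t k])%classic).
  by rewrite -prodEFin; apply: eq_bigr => k _; exact: lebesgue_measure_itv_min.
by move=> k; apply: measurableI; exact: measurable_itv.
Qed.

(** The region over which the order of integration is exchanged. *)
Definition under_box r : set (d.-tuple R * d.-tuple R) :=
  [set p | [/\ lower_box r p.1, orthant p.2 & upper_box p.1 p.2]].

Lemma measurable_under_box r : measurable (under_box r).
Proof.
rewrite (_ : under_box r = fst @^-1` lower_box r `&` snd @^-1` orthant `&`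
  [set p | forall k, tnth p.1 k <= tnth p.2 k]); last first.
  by apply/seteqP; split => p /=; [case|case=> -[]].
apply: measurableI; first apply: measurableI.
- rewrite -[X in measurable X]setTI; apply: measurable_fst => //.
  exact: measurable_lower_box.
- rewrite -[X in measurable X]setTI; apply: measurable_snd => //.
  exact: measurable_orthant.
apply: (measurable_forall_ord
  (A := fun k (p : d.-tuple R * d.-tuple R) => tnth p.1 k <= tnth p.2 k)) => k.
rewrite -[X in measurable X]setTI.
apply: measurable_fun_le => //.
  exact: (measurableT_comp (measurable_tnth k) measurable_fst).
exact: (measurableT_comp (measurable_tnth k) measurable_snd).
Qed.

Lemma xsection_under_box r x : 
  xsection (under_box r) x = if x \in lower_box r then upper_box x else set0.
Proof.
apply/seteqP; split => t; rewrite xsectionE /=.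
  by move=> [rx _ xt]; rewrite mem_set.
case: ifPn => // /set_mem rx xt; split => // k.
by apply: lt_le_trans (xt k); have /andP[] := rx k.
Qed.

Lemma ysection_under_box r t : ysection (under_box r) t =
  if t \in orthant then [set x | lower_box r x /\ upper_box x t] else set0.
Proof.
apply/seteqP; split => x; rewrite ysectionE /=.
  by move=> [rx t0 xt]; rewrite mem_set.
by case: ifPn => // /set_mem t0 [].
Qed.

Lemma measurable_fun_upper_box r :
  measurable_fun (lower_box r) (fun x => tv (upper_box x)).
Proof.
have mr := measurable_lower_box r.
apply/(measurable_restrictT _ mr).
have := measurable_fun_xsection (variationM hmu) (measurable_under_box r).
apply: eq_measurable_fun => x _; rewrite patchE /= xsection_under_box.
by case: ifPn => // _; exact: variation0.
Qed.

(** Sections of [under_box r] at [x] are upper boxes, sections at [t] are the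
    boxes of volume [\prod_k min r_k t_k]. *)
Lemma tail_mass_tonelli r : orthant r ->
  tail_mass mu r = (\int[lebesgue_tuple d]_(x in lower_box r) tv (upper_box x))%E.
Proof.
move=> r0; have mS := measurable_under_box r.
have := indic_fubini_tonelli (lebesgue_tupleM d) (variationM hmu) mS.
rewrite indic_fubini_tonelli_FE// indic_fubini_tonelli_GE// => E.
rewrite /tail_mass -lebesgue_tupleME -[variation_measure mu]/(variationM hmu).
rewrite [LHS]integral_mkcond.
rewrite [RHS]integral_mkcond.
apply/esym; apply: etrans (etrans E _).
  apply: eq_integral => x _; rewrite patchE /= xsection_under_box.
  by case: ifPn => // _; rewrite measure0.
apply: eq_integral => t _; rewrite patchE /= ysection_under_box.
case: ifPn => [/set_mem t0|_]; last by rewrite measure0.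
by rewrite lebesgue_tupleME lebesgue_tuple_min_box.
Qed.

End tail_mass.

(** * Values of the measure on upper boxes *)

Section additivity.
Context {R : realType} {d : nat}.
Variables (mu : set (d.-tuple R) -> R[i]) (hmu : complex_radon mu).
Implicit Types (A B C : set (d.-tuple R)) (F : nat -> set (d.-tuple R)).
Local Notation normc := ComplexField.Normc.normc.
Local Notation tv := (variation_measure mu).

Lemma complex_radon0 : mu set0 = 0.
Proof.
have b0 : bounded_borel (set0 : set (d.-tuple R)).
  exact: bounded_borelS (bounded_borel_exhaustion 0).
have := normc_le_variation mu b0.
rewrite variation0// lee_fin => h.
by apply: ComplexField.Normc.eq0_normc; apply/eqP; rewrite eq_le h normc_ge0.
Qed.

Lemma complex_radonU A B : measurable A -> measurable B ->
  bounded_borel (A `|` B) -> A `&` B = set0 -> mu (A `|` B) = mu A + mu B.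
Proof.
move=> mA mB bAB AB0.
have lim_part (p : R[i] -> R) : p 0 = 0 ->
    (fun n => \sum_(i < n) p (mu (bigcup2 A B i))) @ \oo -->
      p (mu (\bigcup_i bigcup2 A B i)) ->
    p (mu (A `|` B)) = p (mu A) + p (mu B).
  rewrite bigcup2E => p0 cvp; apply: (cvg_unique _ cvp) => //.
  rewrite /= -(cvg_shiftn 2) (_ : (fun _ => _) = cst (p (mu A) + p (mu B))).
    exact: cvg_cst.
  apply/funext => n; rewrite addn2 !big_ord_recl/= big1 ?addr0// => i _.
  by rewrite complex_radon0.
have [|||cRe cIm] := proj1 hmu (bigcup2 A B).
- by move=> [|[|i]] //=; exact: measurable0.
- by rewrite -trivIset_bigcup2.
- by rewrite bigcup2E; case: bAB.
apply/eqP; rewrite eq_complex complexReD complexImD.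
by rewrite (lim_part _ _ cRe)// (lim_part _ _ cIm)// !eqxx.
Qed.

Lemma complex_radonD A B : measurable A -> bounded_borel B -> A `<=` B ->
  mu B = mu A + mu (B `\` A).
Proof.
move=> mA bB AB; have [mB _] := bB.
rewrite -complex_radonU ?setDUK//; first exact: measurableD.
by rewrite setDIK.
Qed.

(** Stated for an additive contraction [p], to be used with [Re] and [Im].  The
    increments of [p (mu (F n))] are bounded by those of the nondecreasing
    sequence [tv (F n)]; therefore the sum of the two sequences is nondecreasing
    and bounded, and the first one is a difference of convergent sequences. *)
Lemma complex_radon_cvg (p : R[i] -> R) F M :
  {morph p : z w / z + w} -> (forall z, `|p z| <= normc z) ->
  (forall n, bounded_borel (F n)) -> {homo F : n m / (n <= m)%N >-> n `<=` m} ->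
  (forall n, (tv (F n) <= M%:E)%E) -> cvgn (fun n => p (mu (F n))).
Proof.
move=> pD p_le bF ndF tvM.
pose u n := p (mu (F n)); pose v n := fine (tv (F n)).
have tvE A : bounded_borel A -> tv A = (fine (tv A))%:E.
  by move=> bA; rewrite fineK// ge0_fin_numE ?variation_ge0//; exact: (proj2 hmu).
have u_le_v A : bounded_borel A -> `|p (mu A)| <= fine (tv A).
  move=> bA; apply: le_trans (p_le _) _.
  by rewrite -lee_fin -tvE//; exact: normc_le_variation.
have vM n : v n <= M by rewrite -lee_fin -tvE.
have v_nd : {homo v : n m / (n <= m)%N >-> n <= m}.
  by move=> n m nm; rewrite -lee_fin -!tvE//; apply: le_variation; exact: ndF.
have cv : cvgn v.
  by apply: nondecreasing_is_cvgn => //; exists M => _ [n _ <-].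
have cuv : cvgn (u \+ v).
  apply: nondecreasing_is_cvgn; last first.
    exists (M + M) => _ [n _ <-]; apply: lerD => //.
    by apply: le_trans (ler_norm _) _; exact: le_trans (u_le_v _ (bF n)) (vM n).
  move=> n m nm /=.
  have [mFn _] := bF n; have [mFm _] := bF m.
  have bD : bounded_borel (F m `\` F n).
    by apply: bounded_borelS (bF m); [exact: measurableD|exact: subDsetl].
  have -> : u m = u n + p (mu (F m `\` F n)).
    by rewrite /u -pD -complex_radonD//; exact: ndF.
  have : v n + fine (tv (F m `\` F n)) <= v m.
    rewrite -lee_fin EFinD -!tvE//.
    apply: le_trans (variation_superadditive _ (setDIK _ _)) _.
    by rewrite setDUK//; exact: ndF.
  have := u_le_v _ bD; rewrite ler_norml => /andP[h1 _] h2.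
  by lra.
rewrite (_ : (fun _ => _) = (u \+ v) \- v); first exact: is_cvgB.
by apply/funext => n /=; rewrite addrK.
Qed.

End additivity.

Section tail_dominates.
Context {R : realType} {d : nat}.
Variables (mu : set (d.-tuple R) -> R[i]) (hmu : complex_radon mu).
Implicit Types x : d.-tuple R.
Local Notation normc := ComplexField.Normc.normc.
Local Notation tv := (variation_measure mu).

(** For [y] in the lower box of [x], the upper box of [y] contains that of [x];
    hence the tail mass at [x] is at least the volume of the lower box times the
    variation of [upper_box x]. *)
Lemma variation_upper_box_fin x : orthant x -> (tail_mass mu x < +oo)%E ->
  (tv (upper_box x) < +oo)%E.
Proof.
move=> x0; rewrite (tail_mass_tonelli hmu)// => fin.
have P0 : 0 < \prod_(k < d) tnth x k by apply: prodr_gt0 => k _; exact: x0.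
have : (tv (upper_box x) * (\prod_(k < d) tnth x k)%:E < +oo)%E.
  apply: le_lt_trans fin.
  rewrite (_ : (\prod_(k < d) _)%:E = lebesgue_tuple d (lower_box x)).
    rewrite -lebesgue_tupleME -integral_cst; last exact: measurable_lower_box.
    apply: ge0_le_integral => //.
    - exact: measurable_lower_box.
    - by move=> y _ /=; exact: variation_ge0.
    - exact: measurable_fun_upper_box.
    move=> y yx; apply: le_variation => t xt k.
    by apply: le_trans (xt k); have /andP[_ /ltW] := yx k.
  transitivity (lebesgue_tuple d [set y | lower_box x y /\ upper_box y x]).
    rewrite lebesgue_tuple_min_box//; congr (_%:E).
    by apply: eq_bigr => k _; rewrite minxx.
  congr (lebesgue_tuple d _); apply/seteqP; split => y /=; first by case.
  by move=> yx; split => // k; have /andP[_ /ltW] := yx k.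
have := variation_ge0 mu (upper_box x).
by case: (tv (upper_box x)) => [r _ _| _|]//; rewrite ?ltry// gt0_mulye.
Qed.

(** On the relatively compact truncations of the upper box the inequality is the
    hypothesis combined with [Re z <= |z|]; both sides converge along the
    exhaustion. *)
Lemma normc_extended_value omega c x : normc omega = 1 ->
  (forall B, bounded_borel B -> (c%:E * tv B <= (complex.Re (omega * mu B))%:E)%E) ->
  orthant x -> (tv (upper_box x) < +oo)%E ->
  (c%:E * tv (upper_box x) <= (normc (extended_value mu (upper_box x)))%:E)%E.
Proof.
move=> omega1 hc x0 fin.
set A := upper_box x; pose F n := A `&` exhaustion n.
have mA : measurable A := measurable_upper_box x.
have bF n : bounded_borel (F n).
  by rewrite /F setIC; apply: bounded_borelIl => //; exact: bounded_borel_exhaustion.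
have ndF : {homo F : n m / (n <= m)%N >-> n `<=` m}.
  by move=> n m nm; apply: setIS; exact: nondecreasing_exhaustion.
have UF : \bigcup_n F n = A.
  rewrite -setI_bigcupr bigcup_exhaustion; apply/setIidPl => t xt k.
  exact: lt_le_trans (xt k).
have tvE B : bounded_borel B -> tv B = (fine (tv B))%:E.
  by move=> bB; rewrite fineK// ge0_fin_numE ?variation_ge0//; exact: (proj2 hmu).
have tvA : tv A = (fine (tv A))%:E by rewrite fineK// ge0_fin_numE ?variation_ge0.
have tvF n : (tv (F n) <= (fine (tv A))%:E)%E.
  by rewrite -tvA; apply: le_variation; exact: subIsetl.
have cRe := complex_radon_cvg hmu (@complexReD R) (@ler_norm_Re R) bF ndF tvF.
have cIm := complex_radon_cvg hmu (@complexImD R) (@ler_norm_Im R) bF ndF tvF.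
have cv : fine (tv (F n)) @[n --> \oo] --> fine (tv A).
  apply: fine_cvg; rewrite -tvA -UF.
  apply: (@nondecreasing_cvg_mu _ _ _ (variationM hmu)).
  - by move=> n; case: (bF n).
  - by rewrite UF.
  - by move=> n m nm; apply/subsetPset; exact: ndF.
rewrite tvA -EFinM lee_fin.
apply: (@le_trans _ _ (complex.Re (omega * extended_value mu A))); last first.
  rewrite -[leRHS]mul1r -omega1 -ComplexField.Normc.normcM.
  exact: le_trans (ler_norm _) (ler_norm_Re _).
rewrite complexReM /extended_value /=.
have cw : complex.Re (omega * mu (F n)) @[n --> \oo] -->
    complex.Re omega * limn (fun n => complex.Re (mu (F n))) -
    complex.Im omega * limn (fun n => complex.Im (mu (F n))).
  rewrite (_ : (fun _ => _) = (fun n => complex.Re omega * complex.Re (mu (F n)) -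
    complex.Im omega * complex.Im (mu (F n)))); last first.
    by apply/funext => n; rewrite complexReM.
  by apply: cvgB; apply: cvgMr.
apply: (ler_cvg_to (cvgMr (a := c) cv) cw).
apply: nearW => n; rewrite -lee_fin EFinM -tvE//; exact: hc.
Qed.

End tail_dominates.

(** * Measures dominating their total variation *)

Section domination.
Context {R : realType} {d : nat}.
Variables (mu : set (d.-tuple R) -> R[i]) (hmu : complex_radon mu).
Implicit Types (B : set (d.-tuple R)) (g h : d.-tuple R -> R[i]).
Local Notation normc := ComplexField.Normc.normc.
Local Notation tv := (variation_measure mu).

Lemma measurable_fun_normc g (D : set (d.-tuple R)) :
  measurable_fun D (fun t => complex.Re (g t)) ->
  measurable_fun D (fun t => complex.Im (g t)) ->
  measurable_fun D (fun t => normc (g t)).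
Proof.
move=> mRe mIm.
rewrite (_ : (fun _ => _) = Num.sqrt \o
  (fun t => complex.Re (g t) ^+ 2 + complex.Im (g t) ^+ 2)); last first.
  by apply/funext => t; rewrite normc_sqrt.
apply: measurableT_comp.
  exact: continuous_measurable_fun (@sqrt_continuous R).
by apply: measurable_funD; apply: measurable_funX.
Qed.

(** Integrating [normc_extended_value] over the lower box of [r] gives the RMGM
    inequality, the left-hand side being the tail mass by Tonelli. *)
Lemma RMGM_of_domination g omega c : is_upper_tail_potential g mu ->
  normc omega = 1 -> 0 < c <= 1 ->
  (forall B, bounded_borel B -> (c%:E * tv B <= (complex.Re (omega * mu B))%:E)%E) ->
  RMGM c^-1 [tuple 1 | _ < d] g.
Proof.
move=> hg omega1 /andP[c0 c1] hc; have [_ mRe mIm gE fin] := hg.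
split; first by rewrite invf_ge1.
  by move=> k; rewrite tnth_mktuple.
exists mu => // r r0.
have -> : mulT [tuple 1 | _ < d] r = r.
  by apply: eq_from_tnth => k; rewrite !tnth_mktuple mul1r.
have mr := measurable_lower_box r.
have rO : lower_box r `<=` orthant by move=> x rx k; have /andP[] := rx k.
have mg : measurable_fun (lower_box r) (fun x => (normc (g x))%:E).
  apply/measurable_EFinP; apply: measurable_fun_normc.
    exact: (measurable_funS measurable_orthant rO mRe).
  exact: (measurable_funS measurable_orthant rO mIm).
rewrite (tail_mass_tonelli hmu)// -lebesgue_tupleME in gE *.
rewrite -ge0_integralZl//; last 2 first.
- by move=> x _; rewrite lee_fin normc_ge0.
- by rewrite lee_fin invr_ge0 ltW.
apply: ae_ge0_le_integral => //.
- by move=> x _; exact: variation_ge0.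
- exact: measurable_fun_upper_box.
- by move=> x _; rewrite -EFinM lee_fin mulr_ge0 ?invr_ge0 ?normc_ge0// ltW.
- by apply: measurable_funeM.
apply: filterS gE => x gx /rO x0.
rewrite gx// lee_pdivlMl//.
apply: (normc_extended_value hmu omega1 hc x0).
by apply: variation_upper_box_fin => //; exact: fin.
Qed.

(** Integrate [kappa <= Re (omega * h)] over [B], the right-hand side being a
    combination of the integrals of [Re h] and [Im h]. *)
Lemma RN_domination h omega kappa : is_RN_derivative mu h ->
  {ae tv, forall t, orthant t -> kappa <= complex.Re (omega * h t)} ->
  0 <= kappa ->
  forall B, bounded_borel B ->
    (kappa%:E * tv B <= (complex.Re (omega * mu B))%:E)%E.
Proof.
move=> [_ [_ hmuE]] hk k0 B bB; have [mB _] := bB.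
have [iRe iIm ->] := hmuE B bB.
rewrite complexReM /=.
pose M := variationM hmu.
rewrite -[tv]/(M : set _ -> _) in iRe iIm hk *.
pose f1 t := ((complex.Re omega)%:E * (complex.Re (h t))%:E)%E.
pose f2 t := ((complex.Im omega)%:E * (complex.Im (h t))%:E)%E.
have i1 : M.-integrable B f1 by exact: integrableZl.
have i2 : M.-integrable B f2 by exact: integrableZl.
rewrite EFinB !EFinM !fineK ?integrable_fin_num//.
rewrite -!integralZl// -integralB//.
have mf : measurable_fun B (fun t => f1 t - f2 t)%E.
  by apply: emeasurable_funB; [exact: measurable_int i1|exact: measurable_int i2].
rewrite -integral_cst//.
(* The pointwise bound holds only almost everywhere and the integrand may be
   negative elsewhere: its maximum with [kappa] is nonnegative everywhere and
   has the same integral. *)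
apply: (@le_trans _ _ (\int[M]_(t in B) maxe kappa%:E (f1 t - f2 t))%E).
  apply: ge0_le_integral => //.
  - by apply: measurable_maxe.
  - by move=> t _; rewrite le_max lexx.
rewrite le_eqVlt; apply/orP; left; apply/eqP.
apply: ae_eq_integral => //; first exact: measurable_maxe.
apply: filterS hk => t ht Bt; apply/max_idPr.
rewrite /f1 /f2 -!EFinM -EFinB lee_fin -complexReM.
by apply: ht; exact: bounded_borel_orthant Bt.
Qed.

(** On a positive [mu] the modulus is the real part, so each sum in the supremum
    is the value of [mu] on a subset of [B], at most its value on [B]. *)
Lemma positive_domination : is_positive mu ->
  forall B, bounded_borel B -> (tv B <= (complex.Re (mu B))%:E)%E.
Proof.
move=> mu0 B bB; have [mB _] := bB.
apply: ge_ereal_sup => _ [n [F [FB tF ->]]].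
have mF i : measurable (F i) by have [[]] := FB i.
have sum_le (s : seq 'I_n) : uniq s ->
    measurable (\big[setU/set0]_(i <- s) F i) /\
    \sum_(i <- s) normc (mu (F i)) =
      complex.Re (mu (\big[setU/set0]_(i <- s) F i)).
  elim: s => [|i s IH] /=.
    by rewrite !big_nil (complex_radon0 hmu).
  move=> /andP[ins /IH[mU sE]]; rewrite !big_cons; split; first exact: measurableU.
  rewrite complex_radonU//.
  - rewrite complexReD sE; congr (_ + _).
    have [bF _] := FB i; have := mu0 _ bF; rewrite lecE => /andP[/eqP Im0 Re0].
    by rewrite normc_sqrt Im0 expr0n addr0 sqrtr_sqr ger0_norm.
  - apply: bounded_borelS bB; first exact: measurableU.
    rewrite -bigcup_seq => t [|[j _]]; first by have [_ FiB] := FB i; exact: FiB.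
    by have [_ FjB] := FB j; exact: FjB.
  - rewrite -bigcup_seq -subset0 => t [Fit [j /= js Fjt]].
    have ij : i = j by apply: tF => //; exists t.
    by move: ins; rewrite ij js.
have [mU ->] := sum_le _ (index_enum_uniq 'I_n).
set U := \big[setU/set0]_(i <- _) F i.
have UB : U `<=` B.
  by rewrite /U -bigcup_seq => t [j _]; have [_ FjB] := FB j; exact: FjB.
rewrite lee_fin (complex_radonD hmu mU bB UB) complexReD lerDl.
have : bounded_borel (B `\` U).
  by apply: bounded_borelS bB; [exact: measurableD|exact: subDsetl].
by move=> /mu0; rewrite lecE => /andP[].
Qed.

End domination.

Theorem proposition5p1 (R : realType) (d : nat) (hd : (0 < d)%N) :
  (forall (g : d.-tuple R -> R[i]) (mu : set (d.-tuple R) -> R[i])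
      (h : d.-tuple R -> R[i]) (omega : R[i]) (kappa : R),
    is_upper_tail_potential g mu ->
    is_RN_derivative mu h ->
    `|omega| = 1 -> 0 < kappa <= 1 ->
    {ae variation_measure mu, forall t, orthant t ->
       kappa <= complex.Re (omega * h t)} ->
    RMGM kappa^-1 [tuple 1 | _ < d] g) /\
  (forall (g : d.-tuple R -> R[i]) (mu : set (d.-tuple R) -> R[i]),
    is_upper_tail_potential g mu -> is_positive mu ->
    RMGM 1 [tuple 1 | _ < d] g).
Proof.
split=> [g mu h omega kappa hg hh omega1 k01 hk|g mu hg mu0].
  have [hmu _ _ _ _] := hg; have /andP[k0 _] := k01.
  apply: (RMGM_of_domination hmu hg _ k01 (RN_domination hmu hh hk (ltW k0))).
  by have := congr1 (@complex.Re R) omega1.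
have [hmu _ _ _ _] := hg.
rewrite -[X in RMGM X]invr1; apply: (RMGM_of_domination hmu hg (omega := 1)).
- exact: ComplexField.Normc.normc1.
- by rewrite ltr01 lexx.
- by move=> B bB; rewrite mul1e mul1r; exact: positive_domination.
Qed.
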